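(* Let $F$ be a field of characteristic $p>0$, let $r=p^e$ with $e\ge1$, $u,s\in F^\times$, $\varepsilon\in\{0,1\}$, $m$ a positive divisor of $r-1$, $\ell=(r-1)/m$, and $$f=S(u,s,\varepsilon,m)=x\,(x^{\ell(r+1)}-\varepsilon us^rx^\ell+us^{r+1})^m\in P_{r^2}(F),\qquad T=\{t\in F: t^{r+1}-\varepsilon ut+u=0\}.$$ For each $t\in T$ and $$g=x(x^\ell-us^rt^{-1})^m,\qquad h=x(x^\ell-st)^m,$$ both in $P_r(F)$, we have $f=g\circ h$. Moreover, $f$ has a $\#T$-collision.
   Context: $P_n(F)$ is the set of monic original polynomials (leading coefficient $1$, constant coefficient $0$) of degree $n$ in $F[x]$. For a nonnegative integer $k$, a $k$-collision of $f\in P_n(F)$ is a set of $k$ distinct pairs $(g,h)$ of monic original polynomials in $F[x]$ of degree at least $2$, all with $g\circ h=g(h)=f$ and all with the same $\deg g$. *)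

(* Defs.v *)
From HB Require Import structures.
From mathcomp Require Import all_boot all_order all_algebra.
From mathcomp Require Import finmap.
From mathcomp Require Import boolp classical_sets functions cardinality.

Set Implicit Arguments.
Unset Strict Implicit.
Unset Printing Implicit Defensive.

Import GRing.Theory.

Local Open Scope ring_scope.

Section Defs.

Variable F : fieldType.

Implicit Types (f g h : {poly F}) (u s eps t : F).

Definition monic_original f : Prop := f \is monic /\ f`_0 = 0.

(* [size f] is the degree plus one. *)
Definition in_P (n : nat) f : Prop := monic_original f /\ size f = n.+1.

Definition is_collision (k : nat) f (C : {fset {poly F} * {poly F}}) : Prop :=
  [/\ #|` C| = k,
      forall g h, (g, h) \in C ->
        [/\ monic_original g, monic_original h,
            (2 < size g)%N, (2 < size h)%N & g \Po h = f]
    & forall g h g' h', (g, h) \in C -> (g', h') \in C -> size g = size g'].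

Definition has_collision (k : nat) f : Prop :=
  exists C : {fset {poly F} * {poly F}}, is_collision k f C.

Definition ell (r m : nat) : nat := (r.-1 %/ m)%N.

Definition S_poly (r : nat) u s eps (m : nat) : {poly F} :=
  'X * ('X^(ell r m * r.+1) - (eps * u * s ^+ r) *: 'X^(ell r m)
        + (u * s ^+ r.+1)%:P) ^+ m.

Definition T_set (r : nat) u eps : set F :=
  [set t : F | t ^+ r.+1 - eps * u * t + u = 0]%classic.

Definition g_poly (r : nat) u s (m : nat) t : {poly F} :=
  'X * ('X^(ell r m) - (u * s ^+ r * t^-1)%:P) ^+ m.

Definition h_poly (r : nat) s (m : nat) t : {poly F} :=
  'X * ('X^(ell r m) - (s * t)%:P) ^+ m.

End Defs.

(* Main.v *)
(** Write [A = 'X^ell]. Since [h ^ ell = A (A - s t)^(r - 1)], composing gives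
    ['X * (A (A - s t)^r - (u s^r / t) (A - s t))^m]; the [r]-th power is additive,
    and [t^r + u / t = eps u] turns the inner polynomial into that of
    [S_poly]. The collision is [t |-> (g_t, h_t)] on [T]: for distinct [t], [t']
    the polynomials [A - s t], [A - s t'] are coprime and nonconstant, so
    their [m]-th powers differ. *)
Require Import Defs.
From mathcomp Require Import all_boot all_order all_algebra.
From mathcomp Require Import finmap.
From mathcomp Require Import boolp classical_sets functions cardinality.
From mathcomp Require Import ring.

Import GRing.Theory.

Local Open Scope ring_scope.

Section Polynomials.

Variable F : fieldType.
Implicit Types (q : {poly F}) (a b s t u eps : F).

Lemma size_trinomial n k a b : (0 < k < n)%N ->
  size ('X^n - a *: 'X^k + b%:P) = n.+1.
Proof.
move=> /andP[k_gt0 lt_kn]; rewrite -addrA size_polyDl size_polyXn// ltnS.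
apply: leq_trans (size_polyD _ _) _; rewrite geq_max size_polyN.
rewrite (leq_trans (size_scale_leq _ _)) ?size_polyXn//=.
by apply: leq_trans (size_polyC_leq1 _) _; apply: leq_trans k_gt0 (ltnW lt_kn).
Qed.

Lemma monic_trinomial n k a b : (0 < k < n)%N ->
  'X^n - a *: 'X^k + b%:P \is monic.
Proof.
move=> lt_kn; rewrite monicE /lead_coef size_trinomial//=.
case/andP: lt_kn => k_gt0 lt_kn.
rewrite coefD coefB coefZ !coefXn coefC eqxx gtn_eqF// mulr0 subr0.
by rewrite gtn_eqF ?addr0// (ltn_trans k_gt0).
Qed.

(** [S_poly], [g_poly] and [h_poly] all have this shape: the factor ['X] kills the constant
    coefficient and adds one to the degree [d * m]. *)
Lemma in_P_mulX_exp q d m n : q \is monic -> size q = d.+1 ->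
  (n = (d * m).+1)%N -> in_P n ('X * q ^+ m).
Proof.
move=> q_monic size_q ->; have qm_monic : q ^+ m \is monic by exact: monic_exp.
split; first by split; [rewrite monicMl ?monicX | rewrite coef0M coefX mul0r].
rewrite mulrC size_mulX ?monic_neq0//; congr _.+1.
have := size_exp q m; rewrite size_q /= => <-.
by rewrite prednK// lt0n size_poly_eq0 monic_neq0.
Qed.

Lemma exp_XnsubC_inj n m a b : (0 < n)%N -> (0 < m)%N ->
  ('X^n - a%:P) ^+ m = ('X^n - b%:P) ^+ m -> a = b.
Proof.
move=> n_gt0 m_gt0 eq_ab; apply/eqP; apply: contraT => neq_ab.
have co_ab : coprimep ('X^n - a%:P) ('X^n - b%:P).
  have -> : 'X^n - b%:P = 1 * ('X^n - a%:P) + (a - b)%:P by rewrite polyCB; ring.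
  rewrite coprimep_addl_mul (@eqp_coprimepr _ _ _ 1) ?coprimep1//.
  by rewrite polyC_eqp1 subr_eq0.
(* Raising one side to the power [m] and rewriting by the equality makes ['X^n - a%:P] coprime to
   itself, impossible in degree [n > 0]. *)
move: co_ab; rewrite -(coprimep_pexpr _ _ m_gt0) -eq_ab coprimep_pexpr//.
by rewrite coprimepp size_XnsubC// eqSS gtn_eqF.
Qed.

(** An infinite root set would contain [size q] distinct roots, more than the degree allows. *)
Lemma finite_roots q : q != 0 -> finite_set [set t | root q t]%classic.
Proof.
move=> q_neq0; apply: contrapT => /(@infinite_set_fset _ _ (size q)) [B sB].
apply/negP; rewrite -ltnNge; apply: max_poly_roots (fset_uniq B) => //.
by apply/allP => t tB; exact: sB.
Qed.

Lemma finite_T_set r u eps : (0 < r)%N -> finite_set (T_set r u eps).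
Proof.
move=> r_gt0; have lt1r : (0 < 1 < r.+1)%N by [].
have := finite_roots _ (monic_neq0 (monic_trinomial _ _ (eps * u) u lt1r)).
apply: sub_finite_set => t /= Tt.
by apply/eqP; rewrite !hornerE.
Qed.

(** At [t = 0] the defining equation leaves [u = 0]. Hence [t^-1] in [g_poly] is a true inverse. *)
Lemma T_set_neq0 r u eps t : u != 0 -> T_set r u eps t -> t != 0.
Proof.
move=> u_neq0; apply: contraPneq => ->; apply/eqP.
by rewrite exprS !(mul0r, mulr0) subr0 add0r.
Qed.

Lemma S_poly_comp r u s eps m t : (0 < r)%N -> [pchar F].-nat r ->
  (m %| r.-1)%N -> u != 0 -> T_set r u eps t ->
  S_poly r u s eps m = g_poly r u s m t \Po h_poly r s m t.
Proof.
move=> r_gt0 char_r m_dvd u_neq0 Tt; have t_neq0 := T_set_neq0 _ _ _ _ u_neq0 Tt.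
rewrite /g_poly comp_polyM comp_polyX rmorphXn /= comp_polyB comp_polyC.
rewrite comp_Xn_poly /h_poly /S_poly exprM; set A := 'X^_.
rewrite -[RHS]mulrA -[in RHS]exprMn; congr (_ * _ ^+ _).
(* Since [m] divides [r.-1], the exponent [m * ell r m] of [A - s t] is exactly [r.-1]; the outer
   factor [B] then completes it to [r]. *)
rewrite exprMn -/A -(exprM _ m) (mulnC m) [(ell r m * m)%N]divnK//; set B := A - _.
set c := u * s ^+ r * t^-1.
have -> : B * (A * B ^+ r.-1 - c%:P) = A * B ^+ r - c%:P * B.
  by rewrite -[in RHS](prednK r_gt0) exprS; ring.
have -> : B ^+ r = A ^+ r - ((s * t) ^+ r)%:P.
  have char_Pr : [pchar {poly F}].-nat r by rewrite (eq_pnat _ (pchar_poly F)).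
  by rewrite exprDn_pchar// exprNn_pchar// polyC_exp.
have cst : c * (s * t) = u * s ^+ r.+1 by rewrite /c exprS; field.
(* Multiplied by [t], this is the equation of [T_set] scaled by [s ^+ r]. *)
have -> : eps * u * s ^+ r = (s * t) ^+ r + c.
  have eqT : eps * u * t = t ^+ r.+1 + u.
    by move: Tt => /= Tt; apply/esym/eqP; rewrite -subr_eq0 addrAC Tt.
  by apply: (mulIf t_neq0); rewrite mulrAC eqT /c exprMn exprS; field.
rewrite -cst exprS -mul_polyC /B !rmorphM !rmorphD /= rmorphM /=; ring.
Qed.

End Polynomials.

Theorem fact3p1 (F : fieldType) (p : nat) (charF : p \in [pchar F])
    (e : nat) (he : (1 <= e)%N) (r : nat) (hr : r = (p ^ e)%N)
    (u s : F) (hu : u != 0) (hs : s != 0)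
    (eps : F) (heps : eps = 0 \/ eps = 1)
    (m : nat) (hm0 : (0 < m)%N) (hm : (m %| r.-1)%N) :
  [/\ in_P (r ^ 2)%N (S_poly r u s eps m),
      forall t : F, T_set r u eps t ->
        [/\ in_P r (g_poly r u s m t),
            in_P r (h_poly r s m t)
          & S_poly r u s eps m = g_poly r u s m t \Po h_poly r s m t],
      finite_set (T_set r u eps)
    & has_collision #|` fset_set (T_set r u eps)|%fset (S_poly r u s eps m)].
Proof.
have p_pr := pcharf_prime charF.
have r_gt1 : (1 < r)%N.
  rewrite hr (leq_trans (prime_gt1 p_pr))// -[leqLHS]expn1.
  by apply: leq_pexp2l he; exact: prime_gt0.
have r_gt0 := ltnW r_gt1.
have char_r : [pchar F].-nat r by rewrite hr pnatX pnatE// charF.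
have rE : r = (ell r m * m).+1 by rewrite divnK// prednK.
have l_gt0 : (0 < ell r m)%N by rewrite divn_gt0// dvdn_leq// -subn1 subn_gt0.
have in_PB (a : F) : in_P r ('X * ('X^(ell r m) - a%:P) ^+ m).
  by apply: in_P_mulX_exp (monicXnsubC _ l_gt0) (size_XnsubC _ l_gt0) rE.
have comp t : T_set r u eps t ->
    S_poly r u s eps m = g_poly r u s m t \Po h_poly r s m t.
  exact: S_poly_comp.
have finT := finite_T_set F r u eps r_gt0.
split=> //.
- have lt_l : (0 < ell r m < ell r m * r.+1)%N.
    by rewrite l_gt0 -[ltnLHS]muln1 ltn_pmul2l.
  apply: in_P_mulX_exp (monic_trinomial _ _ _ _ _ lt_l) (size_trinomial _ _ _ _ _ lt_l) _.
  (* The degree is [(r - 1) * (r + 1) + 1 = r ^ 2]. *)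
  rewrite mulnAC; have -> : (ell r m * m = r.-1)%N by rewrite [in RHS]rE.
  by rewrite -[in LHS](prednK r_gt0) -[in RHS](prednK r_gt0); ring.
- by move=> t Tt; split; [exact: in_PB | exact: in_PB | exact: comp].
exists [fset (g_poly r u s m t, h_poly r s m t) | t in fset_set (T_set r u eps)]%fset.
split.
(* The second component alone separates the pairs: cancel ['X], compare the constants [s * t] and
   [s * t'], then cancel [s]. *)
- rewrite card_imfset// => t t' [_ /(mulfI (negbT (polyX_eq0 F)))].
  by move=> /(exp_XnsubC_inj _ _ _ _ _ l_gt0 hm0)/(mulfI hs).
- move=> g h /imfsetP[t /=]; rewrite in_fset_set// inE => Tt [-> ->].
  have [mg sg] := in_PB (u * s ^+ r * t^-1).
  have [mh sh] := in_PB (s * t).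
  (* Both sizes are [r.+1], so the bound on the degrees is [r_gt1]. *)
  by split; rewrite // /g_poly /h_poly ?sg ?sh -?comp.
- move=> g h g' h' /imfsetP[t _ [-> _]] /imfsetP[t' _ [-> _]].
  by rewrite (in_PB _).2 (in_PB _).2.
Qed.
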